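(* Let $(R,\mathfrak{m})$ be an $F$-pure (commutative Noetherian) local ring of prime characteristic $p$, set $E:=E_R(R/\mathfrak{m})$, and let $\mathfrak{a}\in\mathcal{I}(\Phi(E))$. Then there exists a multiplicatively closed subset $S$ of $R$ such that $\mathfrak{a}$ is the $S$-test ideal $\tau^S(R)$ of $R$. Moreover, $S$ can be taken to be the complement in $R$ of the union of finitely many prime ideals.
   Context: $f(r)=r^p$ is the Frobenius homomorphism. $R[x,f]$ is the Frobenius skew polynomial ring: polynomials $\sum r_ix^i$, free as left $R$-module on $(x^i)_{i\ge0}$, with $xr=r^px$; graded with $n$th component $Rx^n$, an $(R,R)$-bimodule with right action $rx^n\cdot s=rs^{p^n}x^n$. For an $R$-module $M$, $\Phi(M):=R[x,f]\otimes_RM=\bigoplus_{n\ge0}Rx^n\otimes_RM$. $R$ is $F$-pure if for every $R$-module $M$ the map $M\to Rx\otimes_RM$, $m\mapsto x\otimes m$, is injective. For a left $R[x,f]$-module $H$, $\mathcal{I}(H)$ is the set of ideals $(0:_RL)$ for $L$ an $R[x,f]$-submodule of $H$. Multiplicatively closed sets contain $1$. For such $S$ and an $R$-module $M$, $0^{*,S}_M$ is the set of $m\in M$ for which there is $s\in S$ with $sx^n\otimes m=0$ in $Rx^n\otimes_RM$ for all $n\gg0$. An $S$-test element is an $s\in S$ such that for every $R$-module $M$, every $j\ge0$ and every $m\in0^{*,S}_M$, $sx^j\otimes m=0$ in $Rx^j\otimes_RM$; the $S$-test ideal $\tau^S(R)$ is the ideal generated by all $S$-test elements. *)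

(* Defs.v *)
From HB Require Import structures.
From mathcomp Require Import all_boot all_order all_algebra.
Set Implicit Arguments. Unset Strict Implicit. Unset Printing Implicit Defensive.
Import Order.TTheory GRing.Theory.
Local Open Scope ring_scope.

Section Defs.
Variable R : comNzRingType.

Definition is_ideal (I : R -> Prop) :=
  [/\ I 0, (forall a b, I a -> I b -> I (a + b)) & (forall r a, I a -> I (r * a))].

Definition prime_ideal (P : R -> Prop) :=
  [/\ is_ideal P, ~ P 1 & (forall a b, P (a * b) -> P a \/ P b)].

Definition ideal_gen (G : R -> Prop) (r : R) :=
  exists (gs cs : seq R), (forall g, g \in gs -> G g) /\ size cs = size gs /\
    r = \sum_(i < size gs) cs`_i * gs`_i.

Definition noetherian :=
  forall I : R -> Prop, is_ideal I ->
    exists gs : seq R, forall r, I r <-> ideal_gen (fun g => g \in gs) r.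

Definition maxideal (r : R) := ~ exists s : R, r * s = 1.

Definition local_ring := is_ideal maxideal.

Definition mult_closed (S : R -> Prop) :=
  S 1 /\ forall a b, S a -> S b -> S (a * b).

Definition rlinear (A B : lmodType R) (f : A -> B) :=
  forall (a : R) (x y : A), f (a *: x + y) = a *: f x + f y.

Definition submodule (M : lmodType R) (N : M -> Prop) :=
  [/\ N 0, (forall x y, N x -> N y -> N (x + y)) & (forall (a : R) x, N x -> N (a *: x))].

Definition injective_module (E : lmodType R) :=
  forall (A B : lmodType R) (i : A -> B) (g : A -> E),
    rlinear i -> injective i -> rlinear g ->
    exists h : B -> E, rlinear h /\ forall a, h (i a) = g a.

(** E is an injective hull of R/m: E is injective and contains a copy
    R e0 of R/m (e0 <> 0, m e0 = 0) which is essential in E. *)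
Definition injective_hull_residue (E : lmodType R) :=
  injective_module E /\
  exists e0 : E, e0 != 0 /\ (forall r, maxideal r -> r *: e0 = 0) /\
    (forall N : E -> Prop, submodule N -> (exists x, N x /\ x != 0) ->
       exists r : R, N (r *: e0) /\ r *: e0 != 0).

(** Tensor products Rx^n (x)_R M.  A formal sum [(r_1,m_1);...] stands for
    sum_i r_i x^n (x) m_i.  It is zero in Rx^n (x)_R M iff every biadditive
    map b : Rx^n * M -> A that is balanced for the right R-action
    r x^n . s = r s^(p^n) x^n kills it (universal property). *)
Variable p : nat.

Definition balanced (n : nat) (M : lmodType R) (A : zmodType) (b : R -> M -> A) :=
  [/\ (forall r r' m, b (r + r') m = b r m + b r' m),
      (forall r m m', b r (m + m') = b r m + b r m') &
      (forall r s m, b (r * s ^+ (p ^ n)) m = b r (s *: m))].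

Definition tensor_zero (n : nat) (M : lmodType R) (t : seq (R * M)) :=
  forall (A : zmodType) (b : R -> M -> A), balanced n b ->
    \sum_(x <- t) b x.1 x.2 = 0.

Definition F_pure :=
  forall (M : lmodType R) (m : M), tensor_zero 1 [:: (1, m)] -> m = 0.

(** Phi(M) = (+)_n Rx^n (x) M.  A formal sum [((n_i,r_i),m_i)] stands for
    sum_i r_i x^(n_i) (x) m_i. *)
Definition phi_zero (M : lmodType R) (t : seq ((nat * R) * M)) :=
  forall n, tensor_zero n [seq (x.1.2, x.2) | x <- t & x.1.1 == n].

Definition phi_eq (M : lmodType R) (t t' : seq ((nat * R) * M)) :=
  phi_zero (t ++ [seq ((x.1.1, - x.1.2), x.2) | x <- t']).

(** left action of the monomial r x^k of R[x,f]:
    r x^k . (s x^n (x) m) = r s^(p^k) x^(k+n) (x) m *)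
Definition phi_act (M : lmodType R) (r : R) (k : nat) (t : seq ((nat * R) * M)) :=
  [seq ((k + x.1.1, r * x.1.2 ^+ (p ^ k)), x.2) | x <- t].

Definition Rxf_submodule (M : lmodType R) (L : seq ((nat * R) * M) -> Prop) :=
  [/\ (forall t t', L t -> phi_eq t t' -> L t'),
      L [::],
      (forall t t', L t -> L t' -> L (t ++ t')) &
      (forall r k t, L t -> L (phi_act r k t))].

Definition annihilator (M : lmodType R) (L : seq ((nat * R) * M) -> Prop) (r : R) :=
  forall t, L t -> phi_zero (phi_act r 0 t).

Definition in_I_Phi (M : lmodType R) (a : R -> Prop) :=
  exists L : seq ((nat * R) * M) -> Prop, Rxf_submodule L /\ forall r, a r <-> annihilator L r.

Definition S_closure (S : R -> Prop) (M : lmodType R) (m : M) :=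
  exists s, S s /\ exists N, forall n, (N <= n)%N -> tensor_zero n [:: (s, m)].

Definition S_test_element (S : R -> Prop) (s : R) :=
  S s /\ forall (M : lmodType R) (j : nat) (m : M),
    S_closure S m -> tensor_zero j [:: (s, m)].

Definition S_test_ideal (S : R -> Prop) := ideal_gen (S_test_element S).

End Defs.

(* Main.v *)
(** An essential simple socle makes E an injective cogenerator, so a tensor in
    Rx^n (x) M vanishes iff every p^n-semilinear map M -> E kills it; tensor
    products then disappear from the argument. Put J(e) = (0 : R[x,f](1 (x) e))
    for e in E. The members of I(Phi(E)) are the intersections of ideals J(e)
    (call these ideals special); by F-purity they are radical.

    Let F be the set of special ideals not containing a. Its maximal members
    are prime, because special ideals are closed under (b : c). They are
    finitely many: an infinite sequence p_0, p_1, ... of them would make the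
    submodules {e | J(e) contains the intersection of a, p_k, ..., p_l for some l}
    strictly decreasing in k, while E is Artinian. Let S be the complement of
    their union. If J(e) meets S then J(e) is not in F, so it contains a; and a
    meets S by prime avoidance. Hence the S-test elements are exactly the
    elements of a lying in S, and these generate a. *)
Require Import Defs.
From HB Require Import structures.
From mathcomp Require Import all_boot all_order all_algebra.
From mathcomp Require Import zify.
From mathcomp Require Import boolp classical_sets functions cardinality.
Set Implicit Arguments. Unset Strict Implicit. Unset Printing Implicit Defensive.
Import GRing.Theory.
Local Open Scope ring_scope.

(** * Additive maps from [R] to an abelian group, as an [R]-module *)

Section Coinduced.
Variables (R : comNzRingType) (A : zmodType).

Definition additive_pred : {pred R -> A} :=
  fun f => `[< forall u v, f (u + v) = f u + f v >].

Fact additive_pred_closed : zmod_closed additive_pred.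
Proof.
split; first by apply/asboolP => u v; rewrite addr0.
move=> f g /asboolP fD /asboolP gD; apply/asboolP => u v.
by rewrite /GRing.add /GRing.opp /= fD gD opprD addrACA.
Qed.

HB.instance Definition _ :=
  GRing.isZmodClosed.Build (R -> A) additive_pred additive_pred_closed.

Record coinduced :=
  Coinduced { coinduced_fun :> R -> A; _ : coinduced_fun \in additive_pred }.

HB.instance Definition _ := [isSub for coinduced_fun].
HB.instance Definition _ := [Choice of coinduced by <:].
HB.instance Definition _ := [SubChoice_isSubZmodule of coinduced by <:].

Lemma coinducedD (f : coinduced) u v : f (u + v) = f u + f v.
Proof. by case: f => f /= /asboolP. Qed.

Lemma coinducedP (f g : coinduced) : f =1 g -> f = g.
Proof. by move=> fg; apply/val_inj/funext. Qed.

Fact coinduced_scale_subproof (r : R) (f : coinduced) :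
  (fun u => f (u * r)) \in additive_pred.
Proof. by apply/asboolP => u v; rewrite mulrDl coinducedD. Qed.

(** Scalars act on the argument, so $(r f)(1) = f(r)$ and evaluation at [1] recovers every value. *)
Definition coinduced_scale r f := Coinduced (coinduced_scale_subproof r f).

Fact coinduced_scaleA r s f :
  coinduced_scale r (coinduced_scale s f) = coinduced_scale (r * s) f.
Proof. by apply: coinducedP => u /=; rewrite mulrA. Qed.
Fact coinduced_scale1 : left_id 1 coinduced_scale.
Proof. by move=> f; apply: coinducedP => u /=; rewrite mulr1. Qed.
Fact coinduced_scaleDr : right_distributive coinduced_scale +%R.
Proof. by move=> r f g; apply: coinducedP. Qed.
Fact coinduced_scaleDl f : {morph coinduced_scale^~ f : r s / r + s}.
Proof.
by move=> r s; apply: coinducedP => u; rewrite /= mulrDr coinducedD.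
Qed.

HB.instance Definition _ := GRing.Zmodule_isLmodule.Build R coinduced
  coinduced_scaleA coinduced_scale1 coinduced_scaleDr coinduced_scaleDl.

Lemma coinduced_scaleE (r : R) (f : coinduced) u : (r *: f) u = f (u * r).
Proof. by []. Qed.

Lemma coinduced_sumE I (s : seq I) (F : I -> coinduced) u :
  (\sum_(i <- s) F i) u = \sum_(i <- s) F i u.
Proof. by apply: (big_morph (fun f : coinduced => f u)). Qed.

End Coinduced.

(** * Cyclic submodules as modules *)

Section Cyclic.
Variables (R : comNzRingType) (V : lmodType R) (z : V).

Definition cyclic_pred : {pred V} := fun v => `[< exists r : R, v = r *: z >].

Fact cyclic_pred_closed : submod_closed cyclic_pred.
Proof.
split; first by apply/asboolP; exists 0; rewrite scale0r.
move=> c u v /asboolP[r ->] /asboolP[s ->]; apply/asboolP.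
by exists (c * r + s); rewrite scalerDl scalerA.
Qed.

HB.instance Definition _ :=
  GRing.isSubmodClosed.Build R V cyclic_pred cyclic_pred_closed.

Record cyclic_module :=
  CyclicModule { cyclic_val :> V; _ : cyclic_val \in cyclic_pred }.

HB.instance Definition _ := [isSub for cyclic_val].
HB.instance Definition _ := [Choice of cyclic_module by <:].
HB.instance Definition _ := [SubChoice_isSubLmodule of cyclic_module by <:].

Lemma cyclic_moduleP (v : cyclic_module) : exists r : R, val v = r *: z.
Proof. by case: v => v /= /asboolP. Qed.

Lemma cyclic_gen_subproof : z \in cyclic_pred.
Proof. by apply/asboolP; exists 1; rewrite scale1r. Qed.

End Cyclic.

Section RLinear.
Variables (R : comNzRingType) (U V : lmodType R) (f : U -> V).
Hypothesis fL : rlinear f.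

Lemma rlinearD x y : f (x + y) = f x + f y.
Proof. by have := fL 1 x y; rewrite !scale1r. Qed.
Lemma rlinear0 : f 0 = 0.
Proof. by apply: (@addrI _ (f 0)); rewrite -rlinearD !addr0. Qed.
Lemma rlinearZ r x : f (r *: x) = r *: f x.
Proof. by have := fL r x 0; rewrite rlinear0 !addr0. Qed.
Lemma rlinear_sum I (s : seq I) (F : I -> U) :
  f (\sum_(i <- s) F i) = \sum_(i <- s) f (F i).
Proof. by apply: big_morph; [exact: rlinearD | exact: rlinear0]. Qed.
End RLinear.

(** * The injective hull as a cogenerator *)

Section InjectiveHull.
Variables (R : comNzRingType) (E : lmodType R).
Hypothesis hullE : injective_hull_residue E.

(** As [z] is nonzero, its annihilator contains no unit and so kills [e0]: the map $rz \mapsto r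
    e_0$ on $Rz$ is well defined and extends to [V] by injectivity. *)
Lemma injective_hull_cogenerator (V : lmodType R) (z : V) : z <> 0 ->
  exists phi : V -> E, rlinear phi /\ phi z <> 0.
Proof.
case: hullE => injE [e0 [e0N0 [me0 _]]] zN0.
have ann_z (r s : R) : r *: z = s *: z -> r *: e0 = s *: e0.
  move=> rs; apply/eqP; rewrite -subr_eq0 -scalerBl; apply/eqP/me0 => -[t rst].
  by apply: zN0; rewrite -[z]scale1r -rst mulrC -scalerA scalerBl rs subrr scaler0.
have [coef coefP] := choice (@cyclic_moduleP _ _ z).
pose g v := coef v *: e0.
have gL : rlinear g.
  move=> r x y; rewrite /g scalerA -scalerDl; apply: ann_z.
  by rewrite -coefP scalerDl -scalerA -!coefP linearP.
have valL : rlinear (val : cyclic_module z -> V) by move=> *; rewrite linearP.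
have [phi [phiL phig]] := injE _ _ _ g valL val_inj gL.
exists phi; split => //.
have /= -> := phig (CyclicModule (cyclic_gen_subproof z)).
suff -> : g (CyclicModule (cyclic_gen_subproof z)) = 1 *: e0.
  by rewrite scale1r; apply/eqP.
by apply: ann_z; rewrite -coefP scale1r.
Qed.

End InjectiveHull.

(** * Semilinear maps, special ideals and [F_pure] rings *)

Section Semilinear.
Variables (R : comNzRingType) (p : nat).

(** These are the $R$-linear maps $Rx^n \otimes_R M \to N$, evaluated on $x^n \otimes m$. *)
Definition semilinear (n : nat) (M N : lmodType R) (f : M -> N) :=
  (forall x y, f (x + y) = f x + f y) /\
  (forall (r : R) x, f (r *: x) = r ^+ (p ^ n) *: f x).

Lemma semilinear_id (M : lmodType R) : semilinear 0 (@id M).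
Proof. by split=> // r x; rewrite expn0 expr1. Qed.

Lemma semilinear_comp n k (M N Q : lmodType R) (f : M -> N) (g : N -> Q) :
  semilinear n f -> semilinear k g -> semilinear (k + n) (g \o f).
Proof.
move=> [fD fZ] [gD gZ]; split=> [x y|r x] /=; first by rewrite fD gD.
by rewrite fZ gZ -exprM -expnD addnC.
Qed.

Lemma semilinear0 n (M N : lmodType R) (f : M -> N) : semilinear n f -> f 0 = 0.
Proof. by move=> [fD _]; apply: (@addrI _ (f 0)); rewrite -fD !addr0. Qed.

Lemma semilinear_sum n (M N : lmodType R) (f : M -> N) I (s : seq I) (P : pred I)
    (F : I -> M) :
  semilinear n f -> f (\sum_(i <- s | P i) F i) = \sum_(i <- s | P i) f (F i).
Proof.
move=> fS; apply: big_morph; last exact: semilinear0 fS.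
by case: fS.
Qed.

(** [Hom_Z(R, A)] turns a balanced map into a semilinear one, so the tensor
    product itself never has to be constructed. *)
Lemma balanced_semilinear n (M : lmodType R) (A : zmodType) (b : R -> M -> A) :
  balanced p n b ->
  exists2 f : M -> coinduced R A, semilinear n f & forall x r, f x r = b r x.
Proof.
move=> [bDl bDr bZ].
have bA x : (fun r => b r x) \in @additive_pred R A by apply/asboolP => u v.
exists (fun x => Coinduced (bA x)) => //.
by split=> *; apply: coinducedP => u /=; rewrite ?bDr ?bZ.
Qed.

Variable E : lmodType R.
Hypothesis hullE : injective_hull_residue E.

(** A semilinear [f] gives the balanced map $(r, x) \mapsto r f(x)$. Conversely, if the sum [z]
    formed in [coinduced R A] were nonzero, a linear map to [E] not killing [z], composed with [f],
    would contradict the hypothesis. *)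
Lemma tensor_zeroP n (M : lmodType R) (t : seq (R * M)) :
  tensor_zero p n t <->
  forall f : M -> E, semilinear n f -> \sum_(x <- t) x.1 *: f x.2 = 0.
Proof.
split=> [t0 f [fD fZ]|tE A b /balanced_semilinear[f fS fE]].
  apply: (t0 E (fun r x => r *: f x)).
  by split=> *; rewrite ?scalerDl ?fD ?scalerDr ?fZ ?scalerA.
pose z : coinduced R A := \sum_(x <- t) x.1 *: f x.2.
have -> : \sum_(x <- t) b x.1 x.2 = z 1.
  by rewrite coinduced_sumE; apply: eq_bigr => x _; rewrite coinduced_scaleE mul1r fE.
suff -> : z = 0 by [].
apply: contrapT => zN0.
have [phi [phiL phi_z]] := injective_hull_cogenerator hullE zN0.
apply: phi_z; rewrite (rlinear_sum phiL) -[RHS](tE (phi \o f)).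
  by apply: eq_bigr => x _; rewrite (rlinearZ phiL).
rewrite -[n]add0n; apply: semilinear_comp => //.
by split=> [x y|r x]; rewrite ?(rlinearD phiL) ?(rlinearZ phiL) ?expr1.
Qed.

(** The ideal $J(m)$: by [orbit_annP], its members kill every $x^n \otimes m$. *)
Definition orbit_ann (M : lmodType R) (m : M) (r : R) :=
  forall n (f : M -> E), semilinear n f -> r *: f m = 0.

Lemma tensor_zero1P n (M : lmodType R) (r : R) (m : M) :
  tensor_zero p n [:: (r, m)] <->
  forall f : M -> E, semilinear n f -> r *: f m = 0.
Proof.
split=> [/tensor_zeroP r0 f /r0|r0]; first by rewrite big_seq1.
by apply/tensor_zeroP => f /r0; rewrite big_seq1.
Qed.

Lemma orbit_annP (M : lmodType R) (r : R) (m : M) :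
  orbit_ann m r <-> forall n, tensor_zero p n [:: (r, m)].
Proof. split=> h n; last exact/tensor_zero1P.
by apply/tensor_zero1P => f /h. Qed.

(** This moves a question about an arbitrary module [M] into [E]. *)
Lemma orbit_ann_semilinear n (M : lmodType R) (f : M -> E) (m : M) (r : R) :
  semilinear n f -> orbit_ann m r -> orbit_ann (f m) r.
Proof. by move=> fS mr k g gS; exact: (mr _ _ (semilinear_comp fS gS)). Qed.

Lemma orbit_ann_ideal (M : lmodType R) (m : M) : is_ideal (orbit_ann m).
Proof.
split=> [n f fS|r s mr ms n f fS|r s ms n f fS]; first by rewrite scale0r.
  by rewrite scalerDl (mr n) // (ms n) // addr0.
by rewrite -scalerA (ms n) // scaler0.
Qed.

Lemma orbit_annD (x y : E) (r : R) :
  orbit_ann x r -> orbit_ann y r -> orbit_ann (x + y) r.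
Proof. by move=> xr yr n f fS; rewrite fS.1 scalerDr (xr n) // (yr n) // addr0. Qed.

Lemma orbit_annZ (c : R) (x : E) (r : R) : orbit_ann x r -> orbit_ann (c *: x) r.
Proof.
by move=> xr n f fS; rewrite fS.2 scalerA mulrC -scalerA (xr n) // scaler0.
Qed.

Lemma orbit_ann0 (r : R) : orbit_ann (0 : E) r.
Proof. by move=> n f /semilinear0->; rewrite scaler0. Qed.

(** Equivalently, [b] is the annihilator of an R[x,f]-submodule of Phi(E). *)
Definition special (b : R -> Prop) :=
  forall r, (forall e : E, (forall s, b s -> orbit_ann e s) -> orbit_ann e r) -> b r.

Lemma phi_zeroP (M : lmodType R) (t : seq (nat * R * M)) :
  phi_zero p t <-> forall n (f : M -> E), semilinear n f ->
    \sum_(x <- t | x.1.1 == n) x.1.2 *: f x.2 = 0.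
Proof.
split=> [t0 n f fS|t0 n].
  by have /tensor_zeroP/(_ _ fS) := t0 n; rewrite big_map big_filter.
by apply/tensor_zeroP => f /t0; rewrite big_map big_filter.
Qed.

(** A semilinear [f] of degree [n] turns the degree [n] part of [t] in [L] into a vector [e] of [E]
    with $a \subseteq J(e)$; these vectors together detect whether [r] kills [L]. *)
Lemma in_I_Phi_special (a : R -> Prop) : in_I_Phi p E a -> special a.
Proof.
move=> [L [[_ _ _ Lact] aL]] r ar; apply/aL => t Lt; apply/phi_zeroP => n f fS.
pose e := \sum_(x <- t | x.1.1 == n) x.1.2 *: f x.2.
transitivity (r *: e).
  rewrite big_map scaler_sumr; apply: eq_bigr => x _.
  by rewrite /= expn0 expr1 scalerA.
apply: (ar e _ _ _ (semilinear_id E)) => s /aL as_ k g gS.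
(* Tested by [g \o f], the degree [k + n] part of $x^k t$ is [g e]; it is killed by [s] because $x^k
   t$ is again in [L]. *)
have := as_ _ (Lact 1 k _ Lt) => /phi_zeroP /(_ _ _ (semilinear_comp fS gS)).
rewrite !big_map (semilinear_sum _ _ _ gS) scaler_sumr => xt0.
rewrite -[RHS]xt0.
apply: eq_big => [x|x _] /=; first by rewrite add0r eqn_add2l.
by rewrite gS.2 scalerA expn0 expr1 mul1r.
Qed.

Lemma special_ideal b : special b -> is_ideal b.
Proof.
move=> sb; split=> [|r s br bs|r s bs]; apply: sb => e be.
- by case: (orbit_ann_ideal e).
- by case: (orbit_ann_ideal e) => _ + _; apply; apply: be.
- by case: (orbit_ann_ideal e) => _ _; apply; apply: be.
Qed.

Hypothesis p_pr : prime p.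

Let p_expn_gt0 k : (0 < p ^ k)%N. Proof. by rewrite expn_gt0 prime_gt0. Qed.

(** If $b \subseteq J(e)$ then $(b : c) \subseteq J(c f(e))$, because $s g(c f(e)) = c^{p^k - 1}
    (sc) g(f(e))$. *)
Lemma special_colon b c : special b -> special (fun r => b (r * c)).
Proof.
move=> sb r br; apply: sb => e be n f fS; rewrite -scalerA.
apply: (br (c *: f e) _ 0%N id (semilinear_id E)) => s /be sc k g gS.
rewrite gS.2 scalerA.
rewrite -(prednK (p_expn_gt0 k)) exprSr mulrCA -scalerA.
by rewrite (sc _ _ (semilinear_comp fS gS)) scaler0.
Qed.

Hypothesis pureE : F_pure R p.

Lemma F_pure_semilinear (e : E) : e <> 0 ->
  exists2 f : E -> E, semilinear 1 f & f e <> 0.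
Proof.
move=> eN0; apply: contrapT => noF; apply/eN0/pureE/tensor_zero1P => f fS.
by rewrite scale1r; apply: contrapT => feN0; apply: noF; exists f.
Qed.

(** Descent by one degree: if $r f(m) \neq 0$, some [g] of degree 1 has $g(r f(m)) = r^p g(f(m))
    \neq 0$, although $r g(f(m)) = 0$ by induction. This lets [S_closureP] replace all large degrees
    by all degrees. *)
Lemma semilinear_scale_ge N n (M : lmodType R) (m : M) (r : R) :
  (forall k (f : M -> E), (N <= k)%N -> semilinear k f -> r *: f m = 0) ->
  forall f : M -> E, semilinear n f -> r *: f m = 0.
Proof.
move=> rN; have [d] := ubnP (N - n)%N; elim: d n => // d IHd n nN f fS.
have [/rN|ltnN] := leqP N n; first exact.
apply: contrapT => /F_pure_semilinear[g gS]; rewrite gS.2; apply.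
rewrite -(prednK (p_expn_gt0 1)) exprSr -scalerA.
rewrite (IHd _ _ _ (semilinear_comp fS gS)) ?scaler0 // add1n.
by lia.
Qed.

Lemma S_closureP (S : R -> Prop) (M : lmodType R) (m : M) :
  S_closure p S m <-> exists2 s, S s & orbit_ann m s.
Proof.
split=> [[s [Ss [N sN]]]|[s Ss /orbit_annP ms]]; exists s => //; last first.
  by split=> //; exists 0%N.
move=> n; apply: (@semilinear_scale_ge N) => k f /sN /tensor_zero1P; exact.
Qed.

Lemma orbit_ann_radical (e : E) (r : R) : orbit_ann e (r * r) -> orbit_ann e r.
Proof.
move=> er n f fS; apply: contrapT => /F_pure_semilinear[g gS]; rewrite gS.2; apply.
(* As $p \geq 2$, the factor $r^p$ is divisible by [r * r]. *)
have := prime_gt1 p_pr; case: (p) => [|[|q]] // _.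
rewrite expn1 !exprSr -mulrA -scalerA.
by rewrite (er _ _ (semilinear_comp fS gS)) scaler0.
Qed.

Lemma special_radical b r : special b -> b (r * r) -> b r.
Proof. by move=> sb brr; apply: sb => e be; apply/orbit_ann_radical/be. Qed.

End Semilinear.

(** * Ideals and maximal elements in a Noetherian ring *)

Section Noetherian.
Variable R : comNzRingType.
Implicit Types (I : R -> Prop) (G : R -> Prop).

Lemma ideal_sum I (J : Type) (s : seq J) (P : pred J) (F : J -> R) :
  is_ideal I -> (forall j, P j -> I (F j)) -> I (\sum_(j <- s | P j) F j).
Proof. by move=> [I0 ID _] IF; apply: big_ind. Qed.

Lemma ideal_opp I r : is_ideal I -> I r -> I (- r).
Proof. by move=> [_ _ IM] Ir; rewrite -mulN1r; apply: IM. Qed.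

Lemma ideal_gen_mem G g : G g -> ideal_gen G g.
Proof.
move=> Gg; exists [:: g], [:: 1]; split; first by move=> h; rewrite inE => /eqP->.
by split=> //; rewrite big_ord1 mul1r.
Qed.

Lemma ideal_gen_sub G I r :
  is_ideal I -> (forall g, G g -> I g) -> ideal_gen G r -> I r.
Proof.
move=> Iid GI [gs [cs [gsG [_ ->]]]]; apply: ideal_sum => // i _.
by case: Iid => _ _; apply; apply/GI/gsG/mem_nth.
Qed.

Hypothesis noethR : noetherian R.

Lemma noetherian_acc (I : nat -> R -> Prop) :
  (forall n, is_ideal (I n)) -> (forall n r, I n r -> I n.+1 r) ->
  exists n, forall m r, I m r -> I n r.
Proof.
move=> Iid IS.
have Imono m n r : (m <= n)%N -> I m r -> I n r.
  elim: n => [|n IHn]; first by rewrite leqn0 => /eqP->.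
  by rewrite leq_eqVlt => /predU1P[-> //|/IHn mn /mn/IS].
have [|gs gsP] := noethR (I := fun r => exists n, I n r).
  split=> [|r s [m mr] [n ns]|r s [n ns]]; first by exists 0%N; case: (Iid 0).
    exists (maxn m n); case: (Iid (maxn m n)) => _ + _; apply.
      exact: Imono (leq_maxl m n) mr.
    exact: Imono (leq_maxr m n) ns.
  by exists n; case: (Iid n) => _ _; apply.
have [n gsn] : exists n, forall g, g \in gs -> I n g.
  have: forall g, g \in gs -> exists n, I n g by move=> g /ideal_gen_mem/gsP.
  elim: (gs) => [|h hs IHhs] hsI; first by exists 0%N.
  have [|n nI] := IHhs; first by move=> g ghs; apply: hsI; rewrite inE ghs orbT.
  have [|m mI] := hsI h; first exact: mem_head.
  exists (maxn m n) => g; rewrite inE => /predU1P[->|/nI].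
    exact: Imono (leq_maxl m n) mI.
  exact: Imono (leq_maxr m n).
exists n => m r mr; apply: (ideal_gen_sub (Iid n) gsn); apply/gsP; by exists m.
Qed.

Lemma noetherian_max (F : (R -> Prop) -> Prop) b :
  (forall I, F I -> is_ideal I) -> F b ->
  exists q, [/\ F q, (forall r, b r -> q r) &
    forall q', F q' -> (forall r, q r -> q' r) -> q' = q].
Proof.
move=> Fid Fb; apply: contrapT => noq.
pose above := {q | F q /\ forall r, b r -> q r}.
have next (q : above) : exists q' : above,
    (forall r, sval q r -> sval q' r) /\ sval q' <> sval q.
  apply: contrapT => noq'; apply: noq; exists (sval q).
  case: q noq' => q [Fq bq] /= noq'; split=> // q' Fq' qq'.
  apply: contrapT => q'q; apply: noq'.
  by exists (exist _ q' (conj Fq' (fun r br => qq' r (bq r br)))).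
have [g gP] := choice next.
pose I n := iter n g (exist _ b (conj Fb (fun r br => br)) : above).
have [n nP] : exists n, forall m r, sval (I m) r -> sval (I n) r.
  apply: noetherian_acc => [n|n r]; first by apply: Fid; case: (svalP (I n)).
  by case: (gP (I n)) => + _; apply.
case: (gP (I n)) => In; apply; apply/funext => r; apply/propext; split; last exact: In.
exact: (nP n.+1).
Qed.

End Noetherian.

(** * The descending chain condition for submodules *)

Section Descending.
Variables (R : comNzRingType) (M : lmodType R).
Implicit Types (Q : M -> Prop) (T : nat -> M -> Prop).

Definition dcc Q := forall T, (forall n, submodule (T n)) ->
  (forall n x, T n x -> Q x) -> (forall n x, T n.+1 x -> T n x) ->
  exists k, forall n x, (k <= n)%N -> T k x -> T n x.

Lemma decreasing_le T : (forall n x, T n.+1 x -> T n x) ->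
  forall m n x, (m <= n)%N -> T n x -> T m x.
Proof.
move=> TS m n x; elim: n => [|n IHn]; first by rewrite leqn0 => /eqP->.
by rewrite leq_eqVlt => /predU1P[-> //|/IHn mn /TS].
Qed.

(** Dual to lifting the Noetherian property from [M / aM] to [M]: a submodule
    [T] of an [a]-torsion module is determined by the decreasing submodules
    [a ^ i T] intersected with the kernel of [a]. *)
Lemma dcc_torsion (a : R) Q : submodule Q ->
  (forall x, Q x -> exists n, a ^+ n *: x = 0) ->
  dcc (fun x => Q x /\ a *: x = 0) -> dcc Q.
Proof.
move=> [_ _ QZ] Qtors dccQ T Tsub TQ TS.
pose L i k y := a *: y = 0 /\ exists2 x, T k x & y = a ^+ i *: x.
have Lsub i k : submodule (L i k).
  case: (Tsub k) => T0 TD TZ; split.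
  - by split; [rewrite scaler0|exists 0 => //; rewrite scaler0].
  - move=> u v [au [x Tx ux]] [av [y Ty vy]]; split.
      by rewrite scalerDr au av addr0.
    by exists (x + y); [apply: TD|rewrite scalerDr ux vy].
  - move=> c u [au [x Tx ux]]; split; first by rewrite scalerA mulrC -scalerA au scaler0.
    by exists (c *: x); [apply: TZ|rewrite ux !scalerA mulrC].
have LQ i k y : L i k y -> Q y /\ a *: y = 0.
  by move=> [ay [x Tx yx]]; split=> //; rewrite yx; apply/QZ/(TQ k).
have LS1 i k y : L i k.+1 y -> L i k y.
  by move=> [ay [x /TS Tx yx]]; split=> //; exists x.
have LS2 i k y : L i.+1 k y -> L i k y.
  move=> [ay [x Tx yx]]; split=> //; exists (a *: x); last by rewrite yx scalerA exprSr.
  by case: (Tsub k) => _ _; apply.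
have Lle1 i := decreasing_le (LS1 i).
have Lle2 k := @decreasing_le (fun i => L i k) (fun i => @LS2 i k).
(* The diagonal stabilises at [k0], which controls all rows [i >= k0]; the finitely many remaining
   rows are stabilised one at a time. *)
have [k0 k0P] := dccQ (fun k => L k k) (fun k => Lsub k k) (fun k => @LQ k k)
  (fun k y Ly => LS2 _ _ _ (LS1 _ _ _ Ly)).
have [K K0 KP] : exists2 K, (k0 <= K)%N &
    forall i n y, (i < k0)%N -> (K <= n)%N -> L i K y -> L i n y.
  suff: forall m, exists2 K, (k0 <= K)%N &
      forall i n y, (i < m)%N -> (K <= n)%N -> L i K y -> L i n y by exact.
  elim=> [|m [K K0 KP]]; first by exists k0.
  have [k kP] := dccQ (L m) (Lsub m) (@LQ m) (@LS1 m).
  exists (maxn K k) => [|i n y]; first by rewrite leq_max K0.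
  rewrite ltnS leq_eqVlt geq_max => /predU1P[->|im] /andP[Kn kn] Ly.
    by apply: kP => //; apply: Lle1 Ly; apply: leq_maxr.
  by apply: KP => //; apply: Lle1 Ly; apply: leq_maxl.
have {}KP i n y : (K <= n)%N -> L i K y -> L i n y.
  move=> Kn Ly; have [/KP|k0i] := ltnP i k0; first exact.
  apply: (Lle1 i n (maxn i n)); first exact: leq_maxr.
  apply: (Lle2 _ i (maxn i n)); first exact: leq_maxl.
  apply: k0P; first by rewrite leq_max k0i.
  by apply: (Lle2 k0 k0 i) => //; apply: Lle1 Ly.
exists K => n x Kn Tx; have [j] := Qtors x (TQ K x Tx).
(* In the inductive step $a^j x$ is killed by [a], hence equals $a^j y$ with [y] in [T n], and $a^j$
   kills [x - y]. *)
elim: j x Tx => [|j IHj] x Tx ajx.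
  by move: ajx; rewrite expr0 scale1r => ->; case: (Tsub n).
have [|_ [y Ty xy]] := KP j n (a ^+ j *: x) Kn.
  by split; [rewrite scalerA -exprS|exists x].
rewrite -(subrK y x); case: (Tsub n) => _ TD _; apply: TD => //; apply: IHj.
  case: (Tsub K) => _ + TZ; apply=> //; rewrite -scaleN1r; apply: TZ.
  exact: decreasing_le Ty.
by rewrite scalerBr xy subrr.
Qed.

(** [dcc_torsion] removes one element of [gs] at a time, which leaves only their common kernel to be
    treated. *)
Lemma dcc_torsion_seq (gs : seq R) :
  (forall a x, a \in gs -> exists n, a ^+ n *: x = 0 :> M) ->
  dcc (fun x => forall a, a \in gs -> a *: x = 0) -> dcc (fun _ => True).
Proof.
elim: gs => [|a gs IHgs] tors dccgs.
  by move=> T Tsub _; apply: dccgs.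
apply: IHgs => [b x bgs|]; first by apply: tors; rewrite inE bgs orbT.
apply: (@dcc_torsion a) => [|x _|T Tsub TQ]; [|exact: tors (mem_head _ _)|].
  split=> [b _|x y x0 y0 b bgs|c x x0 b bgs]; first by rewrite scaler0.
    by rewrite scalerDr x0 // y0 // addr0.
  by rewrite scalerA mulrC -scalerA x0 // scaler0.
apply: dccgs => // n x /TQ[gs0 a0] b; rewrite inE => /predU1P[->//|]; exact: gs0.
Qed.

End Descending.

Lemma ann_ideal (R : comNzRingType) (M : lmodType R) (x : M) :
  is_ideal (fun r : R => r *: x = 0).
Proof.
split=> [|r s rx sx|r s sx]; first by rewrite scale0r.
  by rewrite scalerDl rx sx addr0.
by rewrite -scalerA sx scaler0.
Qed.

Lemma cyclic_submodule (R : comNzRingType) (M : lmodType R) (x : M) :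
  submodule (fun y => exists r : R, y = r *: x).
Proof.
split=> [|_ _ [r ->] [s ->]|c _ [r ->]]; first by exists 0; rewrite scale0r.
  by exists (r + s); rewrite scalerDl.
by exists (c * r); rewrite scalerA.
Qed.

(** * The injective hull is Artinian *)

Section HullArtinian.
Variables (R : comNzRingType) (E : lmodType R).
Hypotheses (noethR : noetherian R) (locR : local_ring R).
Hypothesis hullE : injective_hull_residue E.

(** The annihilators of the $a^n x$ stabilise at some [n]. If $a^n x \neq 0$, essentiality gives a
    nonzero $r a^n x$ in $R e_0$; then [r] kills $a^{n+1} x$, so by stability also $a^n x$. *)
Lemma injective_hull_torsion (a : R) (x : E) :
  maxideal a -> exists n, a ^+ n *: x = 0.
Proof.
case: hullE => _ [e0 [e0N0 [me0 ess]]] ma.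
have [n|n r /= rx|n nP] := @noetherian_acc _ noethR (fun n r => r *: (a ^+ n *: x) = 0).
- exact: ann_ideal.
- by rewrite exprS -[a * _ *: _]scalerA scalerA mulrC -scalerA rx scaler0.
exists n; apply: contrapT => yN0.
have [|s [[r sr] sN0]] := ess _ (cyclic_submodule (a ^+ n *: x)).
  by exists (a ^+ n *: x); split; [exists 1; rewrite scale1r|apply/eqP].
suff rx : r *: (a ^+ n *: x) = 0 by rewrite sr rx eqxx in sN0.
apply: (nP n.+1); rewrite exprS -scalerA scalerA mulrC -scalerA -sr.
by rewrite scalerA mulrC -scalerA me0 // scaler0.
Qed.

(** The socle is a line: a nonzero vector common to $Rz$ and $R e_0$ has unit coefficients on both
    sides, since [maxideal] kills both [z] and [e0]. *)
Lemma injective_hull_socle (x y : E) : x <> 0 ->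
  (forall a : R, maxideal a -> a *: x = 0) ->
  (forall a : R, maxideal a -> a *: y = 0) -> exists c : R, y = c *: x.
Proof.
case: hullE => _ [e0 [e0N0 [me0 ess]]].
have e0_mult z : z <> 0 -> (forall a : R, maxideal a -> a *: z = 0) ->
    (exists c : R, z = c *: e0) /\ exists c : R, e0 = c *: z.
  move=> zN0 mz.
  have [|s [[r sr] sN0]] := ess _ (cyclic_submodule z).
    by exists z; split; [exists 1; rewrite scale1r|apply/eqP].
  have unit (t : R) (w : E) : t *: w != 0 -> (maxideal t -> t *: w = 0) ->
      exists u, t * u = 1.
    by move=> tN0 tm; apply: contrapT => /tm tw0; rewrite tw0 eqxx in tN0.
  have [t st] := unit s e0 sN0 (me0 s).
  have [|u ru] := unit r z _ (mz r); first by rewrite -sr.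
  split; first by exists (u * s); rewrite -scalerA sr scalerA mulrC ru scale1r.
  by exists (t * r); rewrite -scalerA -sr scalerA mulrC st scale1r.
move=> xN0 mx my; have [-> |yN0] := pselect (y = 0); first by exists 0; rewrite scale0r.
have [_ [c xc]] := e0_mult x xN0 mx; have [[d yd] _] := e0_mult y yN0 my.
by exists (d * c); rewrite -scalerA -xc.
Qed.

Lemma injective_hull_dcc : dcc (fun _ : E => True).
Proof.
have [gs gsP] := noethR locR.
apply: (@dcc_torsion_seq _ _ gs) => [a x ags|T Tsub Tgs TS].
  by apply: injective_hull_torsion; apply/gsP; exact: ideal_gen_mem.
have Tsoc n x : T n x -> forall a : R, maxideal a -> a *: x = 0.
  by move=> /Tgs Tx a /gsP; apply: (ideal_gen_sub (ann_ideal x)).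
have [[k k0]|Tnz] := pselect (exists k, forall x, T k x -> x = 0).
  by exists k => n x _ /k0->; case: (Tsub n).
(* No term vanishes, so each [T n] contains a nonzero socle vector and hence the whole socle: the
   sequence is constant. *)
exists 0%N => n x _ Tx.
have [z [Tz zN0]] : exists z, T n z /\ z <> 0.
  apply: contrapT => noz; apply: Tnz; exists n => z Tz.
  by apply: contrapT => zN0; apply: noz; exists z.
have [c ->] := injective_hull_socle zN0 (Tsoc n z Tz) (Tsoc 0%N x Tx).
by case: (Tsub n) => _ _; apply.
Qed.

End HullArtinian.

(** * Prime avoidance for incomparable primes *)

Section PrimeAvoidance.
Variables (R : comNzRingType) (k : nat) (P : 'I_k -> R -> Prop).
Hypothesis primeP : forall i, prime_ideal (P i).
Hypothesis incomparable : forall i j, i != j -> exists d, P j d /\ ~ P i d.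

Let Pid i : is_ideal (P i). Proof. by case: (primeP i). Qed.

Lemma avoiding_mult_closed : mult_closed (fun r => forall i, ~ P i r).
Proof.
split=> [i|x y xP yP i]; case: (primeP i) => // _ _ Pprime.
by move=> /Pprime[/xP|/yP].
Qed.

Lemma separating_elements :
  exists c : 'I_k -> R, forall i, ~ P i (c i) /\ forall j, j != i -> P j (c i).
Proof.
have /choice[d dP] (ij : 'I_k * 'I_k) :
    exists d, ij.2 != ij.1 -> P ij.2 d /\ ~ P ij.1 d.
  have [->|ji] := eqVneq ij.2 ij.1; first by exists 0.
  by have [|d dP] := @incomparable ij.1 ij.2; [rewrite eq_sym|exists d].
exists (fun i => \prod_(j | j != i) d (i, j)) => i; split=> [|j ji].
  apply: (big_ind (fun x => ~ P i x)) => [|x y xP yP|j ji].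
  - by case: (primeP i).
  - by case: (primeP i) => _ _ Pprime /Pprime[].
  - by have [] := dP (i, j) ji.
rewrite (bigD1 j) //= mulrC; case: (Pid j) => _ _; apply.
by have [] := dP (i, j) ji.
Qed.

Variable a : R -> Prop.
Hypotheses (aid : is_ideal a) (aP : forall i, exists x, a x /\ ~ P i x).

(** Modulo $P_j$ only the summand [x j * c j] survives, and it lies outside $P_j$. *)
Lemma prime_avoidance : exists s, a s /\ forall i, ~ P i s.
Proof.
have [c cP] := separating_elements; have [x xP] := choice aP.
exists (\sum_i x i * c i); split=> [|j].
  apply: ideal_sum => // i _; rewrite mulrC; case: aid => _ _; apply.
  by have [] := xP i.
rewrite (bigD1 j) //= => Pj.
have rest : P j (\sum_(i < k | i != j) x i * c i).
  apply: ideal_sum => // i ij; case: (Pid j) => _ _; apply.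
  by have [_] := cP i; apply; rewrite eq_sym.
have : P j (x j * c j).
  rewrite -(addrK (\sum_(i < k | i != j) x i * c i) (x j * c j)).
  by case: (Pid j) => _ PD _; apply: PD => //; apply: ideal_opp.
case: (primeP j) => _ _ Pprime /Pprime[|]; first by have [] := xP j.
by have [] := cP j.
Qed.

(** Write $r = (r + ds) - ds$ with [s] in [a] outside all the primes and [d] in exactly those $P_j$
    that do not contain [r]; then $r + ds$ avoids every $P_j$ too. *)
Lemma ideal_gen_avoiding (r : R) : a r ->
  ideal_gen (fun s => (forall i, ~ P i s) /\ a s) r.
Proof.
move=> ar; have [s [as_ sP]] := prime_avoidance.
have [c cP] := separating_elements.
pose d := \sum_(i < k | `[< P i r >]) c i.
have dP j : P j d <-> ~ P j r.
  split=> [Pd Pr|Pr].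
    have rest : P j (\sum_(i < k | `[< P i r >] && (i != j)) c i).
      apply: ideal_sum => // i /andP[_ ij].
      by have [_] := cP i; apply; rewrite eq_sym.
    have [+ _] := cP j; apply.
    rewrite -(addrK (\sum_(i < k | `[< P i r >] && (i != j)) c i) (c j)).
    rewrite -bigD1 /=; last exact/asboolP.
    by case: (Pid j) => _ PD _; apply: PD => //; apply: ideal_opp.
  apply: ideal_sum => // i /asboolP Pi.
  have [_] := cP i; apply; apply/eqP => ji; apply: Pr; by rewrite ji.
exists [:: r + d * s; s], [:: 1; - d]; split; last first.
  by split=> //; rewrite big_ord_recl big_ord1 /= mul1r mulNr addrK.
have [_ aD aM] := aid.
move=> g; rewrite !inE => /orP[] /eqP-> //; split=> [j|]; last by apply/aD/aM.
have [_ PD PM] := Pid j; case: (primeP j) => _ _ Pprime Prds.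
have [Pr|Pr] := pselect (P j r).
  have : P j (d * s).
    by rewrite -(addKr r (d * s)); apply: PD => //; apply: ideal_opp.
  by case/Pprime => [/dP//|]; apply: sP.
apply: (Pr); rewrite -(addrK (d * s) r); apply: PD => //; apply: ideal_opp => //.
by rewrite mulrC; apply: PM; apply/dP.
Qed.

End PrimeAvoidance.

(** * Maximal special ideals not containing [a] *)

Section MaximalSpecial.
Variables (R : comNzRingType) (p : nat) (E : lmodType R).
Hypotheses (p_pr : prime p) (noethR : noetherian R) (locR : local_ring R).
Hypotheses (pureR : F_pure R p) (hullE : injective_hull_residue E).
Variables (a : R -> Prop) (aid : is_ideal a).

Definition special_avoiding (b : R -> Prop) :=
  special p E b /\ ~ (forall r, a r -> b r).

Definition max_special_avoiding (q : R -> Prop) := special_avoiding q /\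
  forall q', special_avoiding q' -> (forall r, q r -> q' r) -> q' = q.

Lemma max_special_avoiding_above b : special_avoiding b ->
  exists2 q, max_special_avoiding q & forall r, b r -> q r.
Proof.
move=> Fb; have [I [sI _]|q [Fq bq qmax]] := noetherian_max noethR _ Fb.
  exact: special_ideal sI.
by exists q.
Qed.

Lemma max_special_avoiding_orbit (e : E) :
  ~ (forall r, a r -> orbit_ann p E e r) ->
  exists2 q, max_special_avoiding q & forall r, orbit_ann p E e r -> q r.
Proof.
by move=> ae; apply: max_special_avoiding_above; split=> // r; apply.
Qed.

(** Suppose [c] and [d] are outside [q] but their product is inside. Maximality against $(q : c)$
    gives $ac \subseteq q$; against $(q : s)$ for [s] in [a] it gives $s^2 \in q$, so $a \subseteq
    q$ by radicality. *)
Lemma max_special_avoiding_prime q : max_special_avoiding q -> prime_ideal q.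
Proof.
move=> [[sq aq] qmax]; have qid := special_ideal sq; have [_ _ qM] := qid.
have colon c d : ~ q d -> q (d * c) -> forall s, a s -> q (s * c).
  move=> nqd qdc; apply: contrapT => nac; apply: nqd.
  rewrite -(qmax (fun r => q (r * c))) // => [|r qr].
    by split=> //; apply: special_colon.
  by rewrite mulrC; apply: qM.
split=> // [q1|c d qcd].
  by apply: aq => r _; rewrite -[r]mulr1; apply: qM.
apply: contrapT => /not_orP[nqc nqd]; apply: aq => s as_.
apply: contrapT => nqs; apply: nqs; apply: (special_radical hullE p_pr pureR sq).
apply: (colon s c) => //; rewrite mulrC; apply: (colon c d) => //.
by rewrite mulrC.
Qed.

Lemma max_special_avoiding_incomparable q q' :
  max_special_avoiding q -> max_special_avoiding q' -> q <> q' ->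
  exists d, q' d /\ ~ q d.
Proof.
move=> [Fq _] [_ q'max] qq'; apply: contrapT => nod; apply: qq'.
apply: q'max => // r q'r; apply: contrapT => nqr; apply: nod; by exists r.
Qed.

Lemma max_special_avoiding_finite : finite_set max_special_avoiding.
Proof.
apply: contrapT => /infiniteP/pcard_leP[f].
have fM n : max_special_avoiding (f n) by apply: (@funS _ _ _ _ f).
have finj m n : f m = f n -> m = n by apply: (@inj _ _ _ f); rewrite inE.
(* The range of [i] is half-open: [l = k.+1] leaves [a] and [f k], while [l <= k] leaves [a]
   alone. *)
pose T k (e : E) := exists l, forall r, a r ->
  (forall i, (k <= i < l)%N -> f i r) -> orbit_ann p E e r.
have [k kP] : exists k, forall n e, (k <= n)%N -> T k e -> T n e.
  apply: (injective_hull_dcc noethR locR hullE) => // [n|n e [l lP]]; last first.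
    exists l => r ar fr; apply: lP => // i /andP[ni il]; apply: fr.
    by rewrite il (ltnW ni).
  split=> [|x y [l lP] [m mP]|c x [l lP]].
  - by exists 0%N => r _ _; apply: orbit_ann0.
  - exists (maxn l m) => r ar fr; apply: orbit_annD; [apply: lP|apply: mP] => // i;
      by move=> /andP[ni il]; apply: fr; rewrite ni leq_max il ?orbT.
  - by exists l => r ar fr; apply/orbit_annZ/lP.
have [[sk nak] _] := fM k; have [_ _ kprime] := max_special_avoiding_prime (fM k).
have [e [ke nae]] : exists e : E, (forall s, f k s -> orbit_ann p E e s) /\
    ~ (forall r, a r -> orbit_ann p E e r).
  apply: contrapT => noe; apply: nak => r ar; apply: sk => e ke.
  by apply: contrapT => ner; apply: noe; exists e; split=> // /(_ _ ar).
have [|l lP] := kP k.+1 e (leqnSn k).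
  by exists k.+1 => r _ fr; apply/ke/fr; rewrite leqnn ltnSn.
(* A maximal [q] above $J(e)$ contains [f k], hence equals it; so $J(e) \subseteq f_k$. *)
have [q [Fq qmax] eq_] := max_special_avoiding_orbit nae.
have qk : q = f k by have [_] := fM k; apply=> // r /ke/eq_.
have [x [ax nkx]] : exists x, a x /\ ~ f k x.
  apply: contrapT => nox; apply: nak => r ar.
  by apply: contrapT => nkr; apply: nox; exists r.
have /choice[y yP] i : exists y, i != k -> f i y /\ ~ f k y.
  have [->|ik] := eqVneq i k; first by exists 0.
  have [|y yP] := max_special_avoiding_incomparable (fM k) (fM i); last by exists y.
  by move=> /finj ki; rewrite ki eqxx in ik.
(* The product lies in [a] and in each [f i] with [k < i < l], hence in $J(e)$ because [e] is in
   [T k.+1]; yet no factor lies in the prime [f k]. *)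
have : f k (x * \prod_(k.+1 <= i < l) y i).
  rewrite -qk; apply/eq_/lP => [|i il].
    by case: aid => _ _ aM; rewrite mulrC; apply: aM.
  rewrite (bigD1_seq i) ?mem_index_iota ?iota_uniq //=.
  have [_ _ iM] := special_ideal (fM i).1.1.
  rewrite mulrCA mulrC; apply: iM.
  by have [|] := yP i; first by rewrite gtn_eqF //; case/andP: il.
case/kprime => //; rewrite big_nat_cond.
apply: (big_ind (fun z => ~ f k z)) => [|u v ku kv|i /andP[/andP[ki _] _]].
- by case: (max_special_avoiding_prime (fM k)).
- by case/kprime.
- by have [|] := yP i; first by rewrite gtn_eqF.
Qed.

End MaximalSpecial.

(** * Computation of the [S]-test ideal *)

Theorem theorem2p12 (R : comNzRingType) (p : nat) (E : lmodType R) (a : R -> Prop) :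
  prime p -> p \in [pchar R] ->
  noetherian R -> local_ring R -> F_pure R p ->
  injective_hull_residue E ->
  in_I_Phi p E a ->
  exists (k : nat) (P : 'I_k -> R -> Prop),
    (forall i, prime_ideal (P i)) /\
    let S := fun r => forall i, ~ P i r in
    mult_closed S /\ (forall r, a r <-> S_test_ideal p S r).
Proof.
move=> p_pr _ noethR locR pureR hullE /(in_I_Phi_special hullE) sa.
have aid := special_ideal sa.
have /finite_seqP[s sE] := max_special_avoiding_finite p_pr noethR locR pureR hullE aid.
(* Removing duplicates makes distinct indices give distinct, hence incomparable, primes. If [a] is
   zero, every special ideal contains it, so [k = 0] and [S] is all of [R]. *)
pose k := size (undup s); pose P (i : 'I_k) := nth a (undup s) i.
have PM i : max_special_avoiding p E a (P i).
  have : [set` s]%classic (P i) by rewrite /= -mem_undup mem_nth.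
  by rewrite -sE.
have MP q : max_special_avoiding p E a q -> exists i, q = P i.
  move=> qM; have qs : q \in undup s.
    by rewrite mem_undup; move: qM; rewrite sE.
  have ik : (index q (undup s) < k)%N by rewrite index_mem.
  by exists (Ordinal ik); rewrite /P nth_index.
have primeP i : prime_ideal (P i).
  exact: (max_special_avoiding_prime p_pr pureR hullE (PM i)).
exists k, P; split=> //=; split; first exact: avoiding_mult_closed.
have incomparable i j : i != j -> exists d, P j d /\ ~ P i d.
  move=> /eqP ij; apply: max_special_avoiding_incomparable (PM i) (PM j) _.
  move=> /eqP; rewrite nth_uniq ?undup_uniq // => /eqP ij'.
  exact/ij/val_inj.
have aP i : exists x, a x /\ ~ P i x.
  have [[_ naP] _] := PM i; apply: contrapT => nox; apply: naP => r ar.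
  by apply: contrapT => nPr; apply: nox; exists r.
pose S r := forall i, ~ P i r.
(* Otherwise $J(e)$ would lie in some $P_i$, which [t] avoids. *)
have meet_orbit (e : E) t :
    S t -> orbit_ann p E e t -> forall r, a r -> orbit_ann p E e r.
  move=> St et; apply: contrapT => /(max_special_avoiding_orbit noethR)[q /MP[i ->] eP].
  exact/(St i)/eP.
have testP t : S_test_element p S t <-> S t /\ a t.
  split=> [[St testt]|[St at_]]; split=> //.
    (* Prime avoidance gives [u] in both [a] and [S]. It lies in $J(e)$, so [e] is in the
       [S]-closure and the test element [t] kills every $x^j \otimes e$. *)
    apply: sa => e ae; apply/(orbit_annP p hullE) => j; apply: testt.
    have [u [au uS]] := prime_avoidance primeP incomparable aid aP.
    by apply/(S_closureP hullE p_pr pureR); exists u => //; apply: ae.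
  move=> M j m /(S_closureP hullE p_pr pureR)[u Su mu].
  apply/(tensor_zero1P _ hullE) => f fS.
  (* The map [f] carries [m] into [E]; the identity, of degree 0, then reads off $t f(m) = 0$. *)
  apply: (meet_orbit (f m) u Su _ t at_ _ _ (semilinear_id p E)).
  exact: orbit_ann_semilinear fS mu.
move=> r; split=> [/(ideal_gen_avoiding primeP incomparable aid aP)|].
  have -> // : (fun s => (forall i, ~ P i s) /\ a s) = S_test_element p S.
  by apply/funext => t; apply/propext; rewrite testP.
by apply: ideal_gen_sub => // t /testP[].
Qed.
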